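(* Let $\mathcal{H}$ be a real Hilbert space, let $K:\mathcal{H}\to\mathcal{H}$ be a bounded linear operator, let $\sigma:\mathcal{H}\times\mathcal{H}\to\mathbb{R}$ be a continuous coercive bilinear map, and let $C$ be a non-empty closed convex subset of $\mathcal{H}$. Then for every bounded linear functional $L$ on $\mathcal{H}$ there exist unique $u_0\in C$ and $f_0\in\mathcal{H}$ such that $$\sigma(u_0,v-u_0)\ \ge\ \langle KK^*f_0,\,v-u_0\rangle\quad\text{for every } v\in C,\qquad\text{and}\qquad L(v)=\langle f_0,v\rangle\quad\text{for every } v\in\mathcal{H}.$$ Moreover, if $\sigma$ is symmetric, then $u_0$ is characterized by the property $$u_0\in C\quad\text{and}\quad J_{f_0,\sigma}(u_0)=\min_{v\in C}J_{f_0,\sigma}(v).$$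
   Context: A bilinear map $\sigma:\mathcal{H}\times\mathcal{H}\to\mathbb{R}$ is called coercive if there is a constant $\alpha>0$ with $\sigma(v,v)\ge\alpha\|v\|^2$ for every $v\in\mathcal{H}$, and continuous if there is $\beta>0$ with $|\sigma(u,v)|\le\beta\|u\|\,\|v\|$ for every $u,v\in\mathcal{H}$. For $f_0\in\mathcal{H}$ and a non-empty closed convex set $C\subseteq\mathcal{H}$, the function $J_{f_0,\sigma}:C\to\mathbb{R}$ is defined by $J_{f_0,\sigma}(v)=\frac12\sigma(v,v)-\langle KK^*f_0,v\rangle$. *)

(* Defs.v *)
From HB Require Import structures.
From mathcomp Require Import all_boot all_order all_algebra.
From mathcomp Require Import all_classical all_reals all_analysis.

Set Implicit Arguments.
Unset Strict Implicit.
Unset Printing Implicit Defensive.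

Import Order.TTheory GRing.Theory Num.Theory.
Import numFieldNormedType.Exports.

Local Open Scope classical_set_scope.
Local Open Scope ring_scope.

(* Real Hilbert spaces: complete normed spaces whose norm is induced by a real
   (symmetric, bilinear, positive definite) inner product. *)
HB.mixin Record CompleteNormedModule_isHilbert (R : realType) H
    of CompleteNormedModule R H := {
  inner : {dot H for idfun} ;
  innerE : forall u : H, inner u u = `|u| ^+ 2
}.

#[short(type="hilbertType")]
HB.structure Definition Hilbert (R : realType) :=
  { H of CompleteNormedModule R H & CompleteNormedModule_isHilbert R H }.

(* For bounded K the set below is a singleton, by the Riesz representation of
   u |-> <K u, v>; the default value 0 only matters for unbounded K. *)
Definition adjoint (R : realType) (H : hilbertType R) (K : H -> H) (v : H) : H :=
  xget 0 [set w | forall u, inner (K u) v = inner u w].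

Definition coercive_form (R : realType) (H : normedModType R)
    (sigma : H -> H -> R) : Prop :=
  exists2 alpha : R, 0 < alpha & forall v, alpha * `|v| ^+ 2 <= sigma v v.

Definition continuous_form (R : realType) (H : normedModType R)
    (sigma : H -> H -> R) : Prop :=
  exists2 beta : R, 0 < beta & forall u v, `|sigma u v| <= beta * `|u| * `|v|.

(* The formula makes sense on all of H; minimization is restricted to C by
   minimizes_on. *)
Definition J (R : realType) (H : hilbertType R) (K : H -> H)
    (f0 : H) (sigma : H -> H -> R) (v : H) : R :=
  2^-1 * sigma v v - inner (K (adjoint K f0)) v.

Definition minimizes_on (R : realType) (T : Type) (F : T -> R) (C : set T)
    (u : T) : Prop :=
  C u /\ forall v, C v -> F u <= F v.

(* Main.v *)
(* For a bounded functional l, the function |v|^2 / 2 - l v attains its minimum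
   on C, and its minimizers are the solutions of <u, v - u> >= l (v - u) on C.
   With C the whole space this represents l by a vector, which gives f0; with
   l = <w, .> it gives the projection onto C. For g = K K^* f0, the inequality
   for sigma is then a fixed point problem for a contraction of C (the
   Lions-Stampacchia argument), and coercivity gives uniqueness. Along a segment
   from u to v, J is a quadratic polynomial in the parameter whose derivative at
   0 is sigma (u, v - u) - <g, v - u> when sigma is symmetric, hence the
   variational characterization. *)

Require Import Defs.
From HB Require Import structures.
From mathcomp Require Import all_boot all_order all_algebra.
From mathcomp Require Import all_classical all_reals all_analysis.
From mathcomp Require Import ring lra.

Set Implicit Arguments.
Unset Strict Implicit.
Unset Printing Implicit Defensive.

Import Order.TTheory GRing.Theory Num.Theory.
Import numFieldNormedType.Exports.

Local Open Scope classical_set_scope.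
Local Open Scope ring_scope.

(** * Inner product identities and the Cauchy-Schwarz inequality *)

Section InnerProduct.
Context {R : realType} {H : hilbertType R}.
Implicit Types u v : H.

Lemma innerC u v : inner u v = inner v u.
Proof. by rewrite (hermC inner) expr0 mul1r. Qed.

Lemma normD_sqr u v : `|u + v| ^+ 2 = `|u| ^+ 2 + 2 * inner u v + `|v| ^+ 2.
Proof.
by rewrite -!innerE linearDl !linearDr /= (innerC v u) mulr_natl mulr2n !addrA.
Qed.

Lemma normB_sqr u v : `|u - v| ^+ 2 = `|u| ^+ 2 - 2 * inner u v + `|v| ^+ 2.
Proof. by rewrite normD_sqr linearNr normrN mulrN. Qed.

Lemma normZ_sqr (a : R) u : `|a *: u| ^+ 2 = a ^+ 2 * `|u| ^+ 2.
Proof. by rewrite normrZ exprMn real_normK ?num_real. Qed.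

Lemma innerZ (a b : R) u v : inner (a *: u) (b *: v) = a * b * inner u v.
Proof. by rewrite linearZ /= (linearZl_LR inner) /= mulrCA mulrA. Qed.

(** For nonzero vectors, the squared norm of [|v| u - |u| v] expands to
    [2 |u| |v| (|u| |v| - <u, v>)]. *)
Lemma Cauchy_Schwarz_le u v : inner u v <= `|u| * `|v|.
Proof.
have [->|u0] := eqVneq u 0; first by rewrite linear0l normr0 mul0r.
have [->|v0] := eqVneq v 0; first by rewrite linear0r normr0 mulr0.
have uv_gt0 : 0 < `|u| * `|v| by rewrite mulr_gt0 ?normr_gt0.
have := sqr_ge0 `| `|v| *: u - `|u| *: v |.
rewrite normB_sqr !normZ_sqr innerZ => h.
by rewrite -(ler_pM2l uv_gt0); lra.
Qed.

Lemma Cauchy_Schwarz u v : `|inner u v| <= `|u| * `|v|.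
Proof.
by rewrite ler_norml lerNl -linearNr -{1}(normrN v) !Cauchy_Schwarz_le.
Qed.

End InnerProduct.

(** * Quadratic minimization over convex sets, and Riesz representation *)

Lemma convex_set_segment (R : realType) (H : lmodType R) (C : set H) (u v : H)
    (t : R) : convex_set C -> C u -> C v -> 0 <= t <= 1 -> C (u + t *: (v - u)).
Proof.
move=> cC Cu Cv t01; have := cC v u (Itv01 (andP t01).1 (andP t01).2).
rewrite !inE => /(_ Cv Cu).
rewrite /conv /= /unstable.onem scalerBl scale1r scalerBr.
by rewrite addrCA addrA addrAC.
Qed.

Lemma minimizes_on_quadratic (R : realType) (H : lmodType R) (s : {biscalar H})
    (l : {scalar H}) (C : set H) (u : H) :
  convex_set C -> (forall v w, s v w = s w v) -> (forall v, 0 <= s v v) ->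
  minimizes_on (fun v => 2^-1 * s v v - l v) C u <->
  C u /\ forall v, C v -> l (v - u) <= s u (v - u).
Proof.
move=> cC sC s_ge0.
pose F v := 2^-1 * s v v - l v.
have FE v t : F (u + t *: (v - u)) =
    F u + t * (s u (v - u) - l (v - u)) + t ^+ 2 * (2^-1 * s (v - u) (v - u)).
  rewrite /F; move: (v - u) => d.
  rewrite (linearDl s) !(linearDr s) (linearD l) !(linearZl_LR s) (scalarZ l) /=.
  by rewrite !(linearZr_LR s) /= (sC d u); field.
split=> -[Cu umin]; split=> // v Cv; last first.
  have := FE v 1; rewrite scale1r addrC subrK -/(F u) -/(F v) => ->.
  by have := umin v Cv; have := s_ge0 (v - u); lra.
rewrite leNgt; apply/negP => lt_sl.
set a := s u (v - u) - l (v - u); set b := 2^-1 * s (v - u) (v - u).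
have a_lt0 : a < 0 by rewrite /a subr_lt0.
have b_ge0 : 0 <= b by rewrite /b mulr_ge0 // invr_ge0.
(* As [a < 0 <= b], this [t] lies in []0, 1]], and [a + t b = - a ^+ 2 / (b - a)] is negative, so
   [F] drops below [F u] on the segment. *)
pose t := - a / (b - a).
have ba : 0 < b - a by lra.
have t_gt0 : 0 < t by rewrite divr_gt0 // oppr_gt0.
have tE : t * (b - a) = - a by rewrite /t divfK // gt_eqF.
have t_le1 : t <= 1 by rewrite ler_pdivrMr //; lra.
have := umin _ (convex_set_segment cC Cu Cv _); move/(_ t).
rewrite (ltW t_gt0) t_le1 => /(_ isT).
rewrite -/(F u) -/(F (u + t *: (v - u))) FE -/a -/b.
have : t * (a + t * b) < 0 by rewrite pmulr_rlt0 //; nra.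
lra.
Qed.

(* A minimizing sequence of [|v|^2 / 2 - l v] is Cauchy by the parallelogram
   identity, in which the terms in [l] cancel. *)
Lemma exists_minimizer (R : realType) (H : hilbertType R) (l : {scalar H})
    (M : R) (C : set H) :
  (forall v, `|l v| <= M * `|v|) -> C !=set0 -> closed C -> convex_set C ->
  exists u, minimizes_on (fun v => 2^-1 * inner v v - l v) C u.
Proof.
move=> lM [c Cc] clC cC.
pose F v := 2^-1 * inner v v - l v.
(* Complete the square: [|v|^2 / 2 - M |v| = (|v| - M)^2 / 2 - M^2 / 2]. *)
have F_lb v : - (2^-1 * M ^+ 2) <= F v.
  have := sqr_ge0 (`|v| - M); have := lM v; have := ler_norm (l v).
  by rewrite /F innerE; lra.
have infF : has_inf (F @` C).
  split; first by exists (F c), c.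
  by exists (- (2^-1 * M ^+ 2)) => _ [v _ <-].
set m := inf (F @` C).
have m_le v : C v -> m <= F v.
  by move=> Cv; apply: ge_inf; [exact: infF.2|exists v].
have [x x_min] :
    {x : nat -> H & forall n, C (x n) /\ F (x n) < m + n.+1%:R^-1}.
  apply: (@choice _ _ (fun n v => C v /\ F v < m + n.+1%:R^-1)) => n.
  have [|_ [v Cv <-] ?] := @inf_adherent _ (F @` C) n.+1%:R^-1 _ infF.
    by rewrite invr_gt0.
  by exists v.
(* With [w] the midpoint, [|u - v|^2 = 4 F u + 4 F v - 8 F w], and [m <= F w] by convexity of
   [C]. *)
have mid u v : C u -> C v -> `|u - v| ^+ 2 <= 4 * (F u - m) + 4 * (F v - m).
  move=> Cu Cv.
  have half01 : 0 <= (2^-1 : R) <= 1 by lra.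
  have := m_le _ (convex_set_segment cC Cu Cv half01).
  rewrite /F !innerE (normD_sqr u (_ *: _)) normZ_sqr.
  rewrite (linearD l) (scalarZ l) (linearB l).
  have -> : inner u (2^-1 *: (v - u)) = 2^-1 * (inner u v - `|u| ^+ 2).
    by rewrite (linearZr_LR inner) /= (linearBr inner) /= innerE.
  by rewrite (normB_sqr v u) (normB_sqr u v) (innerC v u); lra.
have x_near e : 0 < e -> \forall n \near \oo, F (x n) < m + e.
  move=> e_gt0; near=> n.
  rewrite (lt_trans (x_min n).2)// ltrD2l.
  by near: n; exact: near_infty_natSinv_lt (PosNum e_gt0).
have x_cauchy : cauchy (x @ \oo).
  apply: cauchy_exP => e e_gt0.
  have [|N _ xN] := x_near (8^-1 * e ^+ 2); first by rewrite mulr_gt0 ?exprn_gt0.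
  exists (x N); exists N => // n Nn /=.
  rewrite -ball_normE /= -(ltr_pXn2r (n := 2)) ?nnegrE ?(ltW e_gt0) //.
  have := mid _ _ (x_min N).1 (x_min n).1.
  by have := xN N (leqnn N); have := xN n Nn; lra.
have /cvg_ex[u xu] : cvg (x @ \oo) by exact/cauchy_cvgP.
have Cu : C u.
  by apply: (closed_cvg C clC _ _ xu); apply: nearW => n; exact: (x_min n).1.
exists u; split=> // v /m_le; apply: le_trans; rewrite -/(F u).
apply/ler_addgt0Pr => e e_gt0.
(* [F u - F (x n) <= k |u - x n|], which is at most [e / 2] for large [n]; the [+ 1] in [uxn] keeps
   the divisor positive when [k = 0]. *)
pose k := `|u| + `|M|; have k_ge0 : 0 <= k by rewrite addr_ge0.
near \oo => n.
have uxn : `|u - x n| * (2 * (k + 1)) <= e.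
  rewrite -ler_pdivlMr ?mulr_gt0 ?ltr_wpDl //; near: n.
  by move/cvgrPdist_le: xu; apply; rewrite divr_gt0 // mulr_gt0 ?ltr_wpDl.
have Fxn : F (x n) < m + e / 2.
  by near: n; apply: x_near; rewrite divr_gt0.
have FuE : F u = F (x n) + inner u (u - x n) - 2^-1 * `|u - x n| ^+ 2
    - l (u - x n).
  by rewrite /F !innerE normB_sqr (linearB l) (linearBr inner) /= innerE; lra.
have := lM (u - x n); have := Cauchy_Schwarz_le u (u - x n).
have := ler_norm (- l (u - x n)); rewrite normrN.
have := ler_wpM2r (normr_ge0 (u - x n)) (ler_norm M).
have := sqr_ge0 (`|u - x n|); have := normr_ge0 (u - x n).
by move: uxn Fxn; rewrite FuE /k; nra.
Unshelve. all: by end_near. Qed.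

Lemma exists_inner_variational (R : realType) (H : hilbertType R)
    (l : {scalar H}) (M : R) (C : set H) :
  (forall v, `|l v| <= M * `|v|) -> C !=set0 -> closed C -> convex_set C ->
  exists u, C u /\ forall v, C v -> l (v - u) <= inner u (v - u).
Proof.
move=> lM C0 clC cC; have [u umin] := exists_minimizer lM C0 clC cC.
exists u; apply/(minimizes_on_quadratic l u cC _ _).1 => //.
  exact: innerC.
by move=> v; rewrite /= innerE sqr_ge0.
Qed.

(** On the whole space, testing the inequality at [w + v] and at [w - v] forces equality. *)
Lemma Riesz_representation (R : realType) (H : hilbertType R)
    (l : {scalar H}) (M : R) :
  (forall v, `|l v| <= M * `|v|) -> exists w, forall v, l v = inner w v.
Proof.
move=> lM.
have [|||w [_ wP]] := @exists_inner_variational _ _ l M setT lM.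
- by exists 0.
- exact: closedT.
- by move=> x y t _ _; rewrite inE.
exists w => v; apply/le_anti/andP; split.
  by have := wP (w + v) I; rewrite addrAC subrr add0r.
have := wP (w - v) I; rewrite addrAC subrr add0r (linearN l) (linearNr inner) /=.
by rewrite lerN2.
Qed.

Lemma inner_inj (R : realType) (H : hilbertType R) (w w' : H) :
  (forall v, inner w v = inner w' v) -> w = w'.
Proof.
move=> ww'; apply/eqP; rewrite -subr_eq0 -normr_eq0 -sqrf_eq0 -innerE.
by rewrite (linearBl inner) /= ww' subrr.
Qed.

(** * Variational inequalities for coercive forms *)

Lemma variational_unique (R : realType) (H : normedModType R)
    (sigma : {biscalar H}) (l : {scalar H}) (C : set H) (u u' : H) :
  coercive_form sigma -> C u -> C u' ->
  (forall v, C v -> l (v - u) <= sigma u (v - u)) ->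
  (forall v, C v -> l (v - u') <= sigma u' (v - u')) -> u = u'.
Proof.
move=> [a a_gt0 co] Cu Cu' uP u'P; apply/eqP; rewrite -subr_eq0 -normr_eq0.
rewrite -sqrf_eq0 eq_le sqr_ge0 andbT -(pmulr_rle0 _ a_gt0).
apply: le_trans (co _) _.
(* Each inequality is tested at the other solution; their sum gives
   [sigma (u - u') (u - u') <= 0]. *)
have := uP _ Cu'; have := u'P _ Cu; rewrite -(opprB u u').
by rewrite (linearN l) (linearNr sigma) (linearBl sigma) /=; lra.
Qed.

(* With [sigma u v = <A u, v>], the solution is the fixed point on [C] of
   [u |-> P (u - r (A u - g))], where [P] is the projection onto [C]; this map
   is a contraction for [r = a / b ^+ 2]. *)
Lemma exists_variational (R : realType) (H : hilbertType R)
    (sigma : {biscalar H}) (g : H) (C : set H) :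
  continuous_form sigma -> coercive_form sigma ->
  C !=set0 -> closed C -> convex_set C ->
  exists u, C u /\ forall v, C v -> inner g (v - u) <= sigma u (v - u).
Proof.
move=> [b0 b0_gt0 co] [a a_gt0 el] C0 clC cC.
(* [b] is a continuity constant that also satisfies [a <= b], which coercivity
   gives for [b0] only when [H] is nontrivial. *)
pose b := a + b0.
have b_gt0 : 0 < b by rewrite addr_gt0.
have cob u v : `|sigma u v| <= b * `|u| * `|v|.
  apply: le_trans (co u v) _.
  by rewrite -!mulrA ler_wpM2r ?mulr_ge0 // lerDr ltW.
have /choice[A AP] u : exists w, forall v, sigma u v = inner w v.
  exact: (@Riesz_representation _ _ (sigma u) (b * `|u|) (cob u)).
have A_sqr u u' : `|A u - A u'| ^+ 2 <= b ^+ 2 * `|u - u'| ^+ 2.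
  set d := A u - A u'; set e := u - u'.
  have dP : `|d| ^+ 2 = sigma e d.
    by rewrite -innerE {1}/d /e (linearBl inner) (linearBl sigma) /= !AP.
  have d_le : `|d| * `|d| <= `|d| * (b * `|e|).
    by rewrite -expr2 dP [leRHS]mulrC (le_trans (ler_norm _)).
  have [d0|d0] := eqVneq `|d| 0.
    by rewrite d0 expr0n /= mulr_ge0 // sqr_ge0.
  rewrite -exprMn lerXn2r ?nnegrE // ?mulr_ge0 // ?(ltW b_gt0) //.
  by rewrite -(ler_pM2l (x := `|d|)) // lt_def d0 normr_ge0.
have /choice[P PP] w :
    exists u, C u /\ forall v, C v -> inner w (v - u) <= inner u (v - u).
  exact: (exists_inner_variational (l := inner w) (Cauchy_Schwarz w)).
(* The inequalities for [P w] and [P w'] add up to [|d|^2 <= <e, d>]; then expand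
   [0 <= |e - d|^2]. *)
have P_sqr w w' : `|P w - P w'| ^+ 2 <= `|w - w'| ^+ 2.
  set d := P w - P w'; set e := w - w'.
  have := (PP w).2 _ (PP w').1; have := (PP w').2 _ (PP w).1.
  rewrite -(opprB (P w) (P w')) -/d !(linearNr inner) /=.
  have eE : inner e d = inner w d - inner w' d by exact: (linearBl inner).
  have dE : `|d| ^+ 2 = inner (P w) d - inner (P w') d.
    by rewrite -innerE; exact: (linearBl inner).
  by have := sqr_ge0 `|e - d|; rewrite normB_sqr; lra.
(* This [r] minimizes [1 - 2 r a + r^2 b^2], the bound on the squared contraction factor; the
   minimum is [k2], nonnegative since [a < b]. *)
pose r := a / b ^+ 2.
pose T u := P (u - r *: (A u - g)).
pose k2 := 1 - a ^+ 2 / b ^+ 2.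
have k2_ge0 : 0 <= k2.
  rewrite subr_ge0 -expr_div_n expr_le1 ?divr_ge0 ?ltW //.
  by rewrite ltr_pdivrMr // mul1r ltrDl.
have k2_lt1 : k2 < 1 by rewrite ltrBlDr ltrDl divr_gt0 // exprn_gt0.
have T_sqr u u' : `|T u - T u'| ^+ 2 <= k2 * `|u - u'| ^+ 2.
  apply: le_trans (P_sqr _ _) _.
  have -> : u - r *: (A u - g) - (u' - r *: (A u' - g))
      = (u - u') - r *: (A u - A u').
    rewrite opprD opprK addrACA [- _ + _]addrC -scalerBr opprB addrA subrK.
    by rewrite -scalerN opprB.
  rewrite normB_sqr normZ_sqr (linearZr_LR inner) /=.
  have -> : inner (u - u') (A u - A u') = sigma (u - u') (u - u').
    by rewrite innerC !(linearBl inner) !(linearBl sigma) /= !AP.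
  have := ler_wpM2l (sqr_ge0 r) (A_sqr u u').
  have r_ge0 : 0 <= r by rewrite divr_ge0 ?sqr_ge0 ?ltW.
  have := ler_wpM2l r_ge0 (el (u - u')).
  have -> : k2 = 1 - 2 * (r * a) + r ^+ 2 * b ^+ 2.
    by rewrite /k2 /r; field; rewrite gt_eqF.
  by lra.
pose k : {nonneg R} := NngNum (sqrtr_ge0 k2).
pose f : {fun C >-> C} :=
  mkfun (fun u (Cu : C u) => (PP (u - r *: (A u - g))).1).
have f_contr : is_contraction f.
  exists k; split=> /=.
    by rewrite -sqrtr1 ltr_sqrt.
  move=> [u u'] _ /=.
  rewrite -(ler_pXn2r (n := 2)) ?nnegrE ?mulr_ge0 ?sqrtr_ge0 //.
  by rewrite exprMn sqr_sqrtr // T_sqr.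
have [u Cu uE] := banach_fixed_point f_contr clC C0.
exists u; split=> // v Cv.
(* At the fixed point, [<u, v - u>] cancels from both sides, leaving [0 <= r <A u - g, v - u>]. *)
have := (PP (u - r *: (A u - g))).2 v Cv.
rewrite -[P _]uE.
have r_gt0 : 0 < r by rewrite divr_gt0 // exprn_gt0.
rewrite AP (linearBl inner) /= (linearZl_LR inner) /= (linearBl inner) /=.
by rewrite gerBl pmulr_rge0 // subr_ge0.
Qed.

Theorem theorem2p1 (R : realType) (H : hilbertType R)
    (K : {linear H -> H}) (K_bounded : bounded_near K (nbhs (0 : H)))
    (sigma : {biscalar H})
    (sigma_continuous : continuous_form sigma)
    (sigma_coercive : coercive_form sigma)
    (C : set H) (C_nonempty : C !=set0) (C_closed : closed C)
    (C_convex : convex_set C)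
    (L : {linear H -> R^o}) (L_bounded : bounded_near L (nbhs (0 : H))) :
  exists u0 f0 : H,
    unique (fun p : H * H =>
      [/\ C p.1,
          forall v, C v ->
            inner (K (adjoint K p.2)) (v - p.1) <= sigma p.1 (v - p.1)
        & forall v, L v = inner p.2 v]) (u0, f0)
    /\ ((forall u v, sigma u v = sigma v u) ->
        forall u, minimizes_on (J K f0 sigma) C u <-> u = u0).
Proof.
have [M LM] : exists M, forall v, `|L v| <= M * `|v|.
  have [M [_ LM]] := (linear_boundedP L).1 L_bounded.
  by exists (M + 1); apply: LM; rewrite ltrDl.
have [f0 f0P] := Riesz_representation (l := L) LM.
set g := K (adjoint K f0).
have [u0 [Cu0 u0P]] := exists_variational g sigma_continuous sigma_coercive
  C_nonempty C_closed C_convex.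
exists u0, f0; split; first split=> //= -[u f] /= [Cu + fP].
  (* [L] alone determines [f0], so both candidates solve the inequality with the same [g]. *)
  have <- : f0 = f by apply: inner_inj => v; rewrite -f0P fP.
  move=> uP; congr pair.
  exact: (variational_unique (l := inner g) sigma_coercive Cu0 Cu u0P uP).
move=> sC u.
have sigma_ge0 v : 0 <= sigma v v.
  have [a a_gt0 co] := sigma_coercive.
  by apply: le_trans (co v); rewrite mulr_ge0 ?sqr_ge0 ?ltW.
have minP := minimizes_on_quadratic (inner g) _ C_convex sC sigma_ge0.
split=> [/(minP u).1[Cu uP]|->]; last exact/(minP u0).2.
exact: (variational_unique (l := inner g) sigma_coercive Cu Cu0 uP u0P).
Qed.
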